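(* Let $M$ be a PTR-submanifold (tangent to $\xi$) of a Sasakian manifold, with chosen totally real distribution $\mathcal D^{\perp}$ and ambiguous distribution $\widetilde{\mathcal D}$. If $M$ is a PTR-product in the direct sense, then $P|_{\widetilde{\mathcal D}}=0$. Consequently no proper PTR-submanifold tangent to $\xi$ is a direct two-factor PTR-product.
   Context: A Sasakian manifold $(\overline M^{2m+1},\phi,\xi,\eta,g)$ consists of a Riemannian metric $g$ with Levi-Civita connection $\widetilde\nabla$, a $(1,1)$-tensor field $\phi$, a vector field $\xi$ (the Reeb field) and a 1-form $\eta$ with $\phi^2X=-X+\eta(X)\xi$, $\eta(\xi)=1$, $\phi\xi=0$, $g(\phi X,\phi Y)=g(X,Y)-\eta(X)\eta(Y)$ and $(\widetilde\nabla_X\phi)Y=g(X,Y)\xi-\eta(Y)X$; in particular $\widetilde\nabla_X\xi=-\phi X$. Let $M$ be an immersed submanifold of $\overline M$ with $\xi\in\Gamma(TM)$, with the induced metric. For $X\in TM$ write $\phi X=PX+FX$ with $PX$ tangent and $FX$ normal. A PTR (partially totally real) submanifold is such an $M$ with a chosen nonzero constant-rank distribution $\mathcal D^{\perp}\subset TM\cap\ker\eta$ satisfying $\phi\mathcal D^{\perp}\subset T^{\perp}M$. The ambiguous distribution $\widetilde{\mathcal D}$ is the orthogonal complement of $\mathcal D^{\perp}\oplus\langle\xi\rangle$ in $TM$, so $TM=\mathcal D^{\perp}\oplus\widetilde{\mathcal D}\oplus\langle\xi\rangle$. A PTR-submanifold is a direct (two-factor) PTR-product if it has the direct product structure of the two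 PTR distributions: $\mathcal D^{\perp}$ and $\widetilde{\mathcal D}$ are both integrable and their leaves, which are the two factors, are totally geodesic in $M$. On an open region where the geometric type of $\widetilde{\mathcal D}$ is constant, the PTR structure is called proper if $\widetilde{\mathcal D}$ is neither totally real ($\phi\widetilde{\mathcal D}\subset T^\perp M$) nor $\phi$-invariant ($\phi\widetilde{\mathcal D}=\widetilde{\mathcal D}$), and is neither slant nor pointwise slant. A distribution $D\subset TM\cap\ker\eta$ is pointwise slant if for each point $p$ the angle between $\phi X$ and $D_p$ is the same for all nonzero $X\in D_p$, and slant if this angle is moreover independent of $p$. *)

(* Defs.v *)
From mathcomp Require Import all_boot all_order all_algebra.
From mathcomp Require Import all_classical all_reals all_analysis.

Set Implicit Arguments.
Unset Strict Implicit.
Unset Printing Implicit Defensive.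

Import Order.TTheory GRing.Theory Num.Theory.
Import numFieldNormedType.Exports.

Local Open Scope classical_set_scope.
Local Open Scope ring_scope.

(** * Calculus on open subsets of R^n *)

(* [U] is meant to be open, so that the pointwise notions are those of [U]. *)
Fixpoint Ck (R : realType) (n : nat) (V : normedModType R) (k : nat)
    (U : set 'rV[R]_n) (h : 'rV[R]_n -> V) : Prop :=
  if k is k'.+1 then
    (forall x, U x -> differentiable h x) /\
    (forall v : 'rV[R]_n, Ck k' U (fun x => 'D_v h x))
  else forall x, U x -> {for x, continuous h}.

Definition smooth_on (R : realType) (n : nat) (V : normedModType R)
    (U : set 'rV[R]_n) (h : 'rV[R]_n -> V) : Prop :=
  forall k, Ck k U h.

Definition smooth_near (R : realType) (n : nat) (V : normedModType R)
    (x : 'rV[R]_n) (h : 'rV[R]_n -> V) : Prop :=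
  exists U : set 'rV[R]_n, [/\ open U, U x & smooth_on U h].

(** * Smooth manifolds *)

(* [para] is only meaningful on the open set [coord @` dom]. *)
Record chart (R : realType) (T : topologicalType) (n : nat) := Chart {
  dom : set T;
  coord : T -> 'rV[R]_n;
  para : 'rV[R]_n -> T;
  dom_open : open dom;
  image_open : open (coord @` dom);
  coordK : forall p, dom p -> para (coord p) = p;
  coord_continuous : forall p, dom p -> {for p, continuous coord};
  para_continuous : forall x, (coord @` dom) x -> {for x, continuous para}
}.

(* The smooth structure is the one generated by a family of compatible charts
   indexed by points, [chart_at p] being a chart around [p].  The tangent space
   at [p] is then 'rV[R]_n, a tangent vector being given by its components in
   the preferred chart [chart_at p]; the same point seen in another chart is
   handled by [comp_in] below. *)
Record manifold (R : realType) (n : nat) := Manifold {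
  carrier :> topologicalType;
  chart_at : carrier -> chart R carrier n;
  manifold_hausdorff : hausdorff_space carrier;
  manifold_second_countable : @second_countable carrier;
  chart_at_dom : forall p, dom (chart_at p) p;
  chart_at_compat : forall p q,
    smooth_on (coord (chart_at p) @` (dom (chart_at p) `&` dom (chart_at q)))
      (coord (chart_at q) \o para (chart_at p))
}.

Definition coord_at (R : realType) (n : nat) (M : manifold R n) (p : M) :
  M -> 'rV[R]_n := coord (chart_at p).

Definition para_at (R : realType) (n : nat) (M : manifold R n) (p : M) :
  'rV[R]_n -> M := para (chart_at p).

Definition vfield (R : realType) (n : nat) (M : manifold R n) : Type :=
  M -> 'rV[R]_n.

(* Components in the chart [chart_at p] of a tangent vector [v] at [q], for [q]
   in the domain of that chart. *)
Definition comp_in (R : realType) (n : nat) (M : manifold R n) (p q : M)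
    (v : 'rV[R]_n) : 'rV[R]_n :=
  'd (coord_at p \o para_at q) (coord_at q q) v.

(* The coordinate expression of the vector field [X] in [chart_at p]. *)
Definition vfield_in (R : realType) (n : nat) (M : manifold R n) (p : M)
    (X : vfield M) : 'rV[R]_n -> 'rV[R]_n :=
  fun x => comp_in p (para_at p x) (X (para_at p x)).

(* Vector fields and functions are total on M but are only constrained near the
   point of interest: they play the role of local sections around [p]. *)
Definition smooth_vfield_at (R : realType) (n : nat) (M : manifold R n) (p : M)
    (X : vfield M) : Prop :=
  smooth_near (coord_at p p) (vfield_in p X).

Definition smooth_fun_at (R : realType) (n : nat) (M : manifold R n) (p : M)
    (h : M -> R) : Prop :=
  smooth_near (coord_at p p) (h \o para_at p).

Definition dfun (R : realType) (n : nat) (M : manifold R n) (p : M)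
    (h : M -> R) (v : 'rV[R]_n) : R :=
  'd (h \o para_at p) (coord_at p p) v.

Definition local_expr (R : realType) (m n : nat) (M : manifold R m)
    (N : manifold R n) (f : M -> N) (p : M) : 'rV[R]_m -> 'rV[R]_n :=
  coord_at (f p) \o f \o para_at p.

Definition smooth_map (R : realType) (m n : nat) (M : manifold R m)
    (N : manifold R n) (f : M -> N) : Prop :=
  continuous f /\ forall p, smooth_near (coord_at p p) (local_expr f p).

Definition dmap (R : realType) (m n : nat) (M : manifold R m)
    (N : manifold R n) (f : M -> N) (p : M) (v : 'rV[R]_m) : 'rV[R]_n :=
  'd (local_expr f p) (coord_at p p) v.

Definition immersion (R : realType) (m n : nat) (M : manifold R m)
    (N : manifold R n) (f : M -> N) : Prop :=
  smooth_map f /\ forall p, injective (dmap f p).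

Definition lie_bracket (R : realType) (n : nat) (M : manifold R n)
    (X Y : vfield M) : vfield M :=
  fun p => 'd (vfield_in p Y) (coord_at p p) (X p)
         - 'd (vfield_in p X) (coord_at p p) (Y p).

(** * Riemannian metrics and the Levi-Civita connection *)

Definition metric_field (R : realType) (n : nat) (M : manifold R n) : Type :=
  M -> 'rV[R]_n -> 'rV[R]_n -> R.

Record riemannian_metric (R : realType) (n : nat) (M : manifold R n)
    (g : metric_field M) : Prop := RiemannianMetric {
  metric_linear : forall p v, scalar (fun u => g p u v);
  metric_sym : forall p u v, g p u v = g p v u;
  metric_pos : forall p u, u != 0 -> 0 < g p u u;
  metric_smooth : forall p (X Y : vfield M),
    smooth_vfield_at p X -> smooth_vfield_at p Y ->
    smooth_fun_at p (fun q => g q (X q) (Y q))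
}.

(* [nabla p v Y] is the covariant derivative of [Y] at [p] in the direction [v];
   its values are unconstrained when [Y] is not smooth around [p]. *)
Definition covder (R : realType) (n : nat) (M : manifold R n) : Type :=
  forall p : M, 'rV[R]_n -> vfield M -> 'rV[R]_n.

Record affine_connection (R : realType) (n : nat) (M : manifold R n)
    (nabla : covder M) : Prop := AffineConnection {
  nabla_linear : forall p (Y : vfield M), smooth_vfield_at p Y ->
    linear (fun v => nabla p v Y);
  nabla_add : forall p v (Y Z : vfield M),
    smooth_vfield_at p Y -> smooth_vfield_at p Z ->
    nabla p v (fun q => Y q + Z q) = nabla p v Y + nabla p v Z;
  nabla_leibniz : forall p v (h : M -> R) (Y : vfield M),
    smooth_fun_at p h -> smooth_vfield_at p Y ->
    nabla p v (fun q => h q *: Y q) = dfun p h v *: Y p + h p *: nabla p v Y;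
  nabla_smooth : forall p (X Y : vfield M),
    smooth_vfield_at p X -> smooth_vfield_at p Y ->
    smooth_vfield_at p (fun q => nabla q (X q) Y)
}.

Record levi_civita (R : realType) (n : nat) (M : manifold R n)
    (g : metric_field M) (nabla : covder M) : Prop := LeviCivita {
  lc_connection : affine_connection nabla;
  lc_torsion_free : forall p (X Y : vfield M),
    smooth_vfield_at p X -> smooth_vfield_at p Y ->
    nabla p (X p) Y - nabla p (Y p) X = lie_bracket X Y p;
  lc_metric : forall p v (Y Z : vfield M),
    smooth_vfield_at p Y -> smooth_vfield_at p Z ->
    dfun p (fun q => g q (Y q) (Z q)) v
      = g p (nabla p v Y) (Z p) + g p (Y p) (nabla p v Z)
}.

(** * Sasakian manifolds *)

Record sasakian (R : realType) (m : nat) (N : manifold R m.*2.+1) := Sasakian {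
  metric : metric_field N;
  conn : covder N;
  phi : forall p : N, {linear 'rV[R]_(m.*2.+1) -> 'rV[R]_(m.*2.+1)};
  reeb : vfield N;
  eta : forall p : N, {scalar 'rV[R]_(m.*2.+1)};
  metricP : riemannian_metric metric;
  connP : levi_civita metric conn;
  phi_smooth : forall p (X : vfield N),
    smooth_vfield_at p X -> smooth_vfield_at p (fun q => phi q (X q));
  reeb_smooth : forall p, smooth_vfield_at p reeb;
  eta_smooth : forall p (X : vfield N),
    smooth_vfield_at p X -> smooth_fun_at p (fun q => eta q (X q));
  phi_sq : forall p X, phi p (phi p X) = - X + eta p X *: reeb p;
  eta_reeb : forall p, eta p (reeb p) = 1;
  phi_reeb : forall p, phi p (reeb p) = 0;
  metric_phi : forall p X Y,
    metric p (phi p X) (phi p Y) = metric p X Y - eta p X * eta p Y;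
  (* (nabla_X phi) Y = g(X, Y) xi - eta(Y) X *)
  nabla_phi : forall p X (Y : vfield N), smooth_vfield_at p Y ->
    conn p X (fun q => phi q (Y q)) - phi p (conn p X Y)
      = metric p X (Y p) *: reeb p - eta p (Y p) *: X
}.

(** * Distributions, integrability, leaves *)

Definition tangent_distr (R : realType) (n : nat) (M : manifold R n) : Type :=
  forall p : M, set 'rV[R]_n.

(* The rows of [E q] are a smooth local frame of the distribution. *)
Definition smooth_distribution (R : realType) (n : nat) (M : manifold R n)
    (r : nat) (D : tangent_distr M) : Prop :=
  forall p : M, exists E : M -> 'M[R]_(r, n),
    (forall i, smooth_vfield_at p (fun q => row i (E q))) /\
    (\forall q \near p,
       row_free (E q) /\ D q = [set v : 'rV[R]_n | (v <= E q)%MS]).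

Definition integral_manifold (R : realType) (n k : nat) (M : manifold R n)
    (D : tangent_distr M) (L : manifold R k) (i : L -> M) : Prop :=
  [/\ immersion i, injective i & forall q, range (dmap i q) = D (i q)].

Definition integrable_distr (R : realType) (n : nat) (M : manifold R n)
    (D : tangent_distr M) : Prop :=
  forall p : M, exists (k : nat) (L : manifold R k) (i : L -> M),
    integral_manifold D i /\ range i p.

Definition leaf (R : realType) (n k : nat) (M : manifold R n)
    (D : tangent_distr M) (L : manifold R k) (i : L -> M) : Prop :=
  [/\ integral_manifold D i,
      connected [set: L]
    & forall (k' : nat) (L' : manifold R k') (i' : L' -> M),
        integral_manifold D i' -> connected [set: L'] ->
        range i `<=` range i' -> range i' `<=` range i].

(* Vanishing of the second fundamental form, computed with local extensions of
   tangent fields of L: the covariant derivative in M stays tangent to L. *)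
Definition totally_geodesic (R : realType) (n k : nat) (M : manifold R n)
    (nabla : covder M) (L : manifold R k) (i : L -> M) : Prop :=
  forall (q : L) (X Y : vfield M),
    smooth_vfield_at (i q) X -> smooth_vfield_at (i q) Y ->
    (\forall q' \near q, range (dmap i q') (X (i q'))) ->
    (\forall q' \near q, range (dmap i q') (Y (i q'))) ->
    range (dmap i q) (nabla (i q) (X (i q)) Y).

(** * PTR-submanifolds *)

Definition induced_metric (R : realType) (m n : nat) (N : manifold R m.*2.+1)
    (S : sasakian N) (M : manifold R n) (f : M -> N) : metric_field M :=
  fun p u v => metric S (f p) (dmap f p u) (dmap f p v).

Definition normal_vector (R : realType) (m n : nat) (N : manifold R m.*2.+1)
    (S : sasakian N) (M : manifold R n) (f : M -> N) (p : M)
    (w : 'rV[R]_(m.*2.+1)) : Prop :=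
  forall Z, metric S (f p) w (dmap f p Z) = 0.

(* phi X for X tangent to M at [p], as a tangent vector of the ambient
   manifold. *)
Definition phi_along (R : realType) (m n : nat) (N : manifold R m.*2.+1)
    (S : sasakian N) (M : manifold R n) (f : M -> N) (p : M) (X : 'rV[R]_n) :
    'rV[R]_(m.*2.+1) :=
  phi S (f p) (dmap f p X).

(* P X, the unique tangent vector such that phi X - P X is normal. *)
Definition tangential_phi (R : realType) (m n : nat) (N : manifold R m.*2.+1)
    (S : sasakian N) (M : manifold R n) (f : M -> N) (p : M) (X : 'rV[R]_n) :
    'rV[R]_n :=
  xget 0 [set Y | normal_vector S f p (phi_along S f p X - dmap f p Y)].

Record ptr_submanifold (R : realType) (m n : nat) (N : manifold R m.*2.+1)
    (S : sasakian N) (M : manifold R n) (f : M -> N) (Dperp : tangent_distr M) :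
    Prop := PTRSubmanifold {
  ptr_immersion : immersion f;
  ptr_reeb_tangent : forall p, range (dmap f p) (reeb S (f p));
  ptr_distribution : exists2 r, (0 < r)%N & smooth_distribution r Dperp;
  ptr_ker_eta : forall p X, Dperp p X -> eta S (f p) (dmap f p X) = 0;
  ptr_totally_real : forall p X, Dperp p X ->
    normal_vector S f p (phi_along S f p X)
}.

Definition ambiguous (R : realType) (m n : nat) (N : manifold R m.*2.+1)
    (S : sasakian N) (M : manifold R n) (f : M -> N) (Dperp : tangent_distr M) :
    tangent_distr M :=
  fun p => [set X | (forall Z, Dperp p Z -> induced_metric S f p X Z = 0) /\
                    metric S (f p) (dmap f p X) (reeb S (f p)) = 0].

Record direct_ptr_product (R : realType) (m n : nat) (N : manifold R m.*2.+1)
    (S : sasakian N) (M : manifold R n) (nabla : covder M) (f : M -> N)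
    (Dperp : tangent_distr M) : Prop := DirectPTRProduct {
  perp_integrable : integrable_distr Dperp;
  ambiguous_integrable : integrable_distr (ambiguous S f Dperp);
  perp_leaves_geodesic : forall (k : nat) (L : manifold R k) (i : L -> M),
    leaf Dperp i -> totally_geodesic nabla i;
  ambiguous_leaves_geodesic : forall (k : nat) (L : manifold R k) (i : L -> M),
    leaf (ambiguous S f Dperp) i -> totally_geodesic nabla i
}.

(** * Geometric types of a distribution and proper PTR structures *)

Definition angle (R : realType) (n : nat) (M : manifold R n)
    (g : metric_field M) (p : M) (u v : 'rV[R]_n) : R :=
  acos (g p u v / (Num.sqrt (g p u u) * Num.sqrt (g p v v))).

(* The angle between a vector and a subspace is the smallest angle with a
   nonzero vector of the subspace. *)
Definition angle_subspace (R : realType) (n : nat) (M : manifold R n)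
    (g : metric_field M) (p : M) (u : 'rV[R]_n) (W : set 'rV[R]_n) : R :=
  inf [set angle g p u w | w in [set w | W w /\ w != 0]].

Definition phi_angle (R : realType) (m n : nat) (N : manifold R m.*2.+1)
    (S : sasakian N) (M : manifold R n) (f : M -> N) (D : tangent_distr M)
    (p : M) (X : 'rV[R]_n) : R :=
  angle_subspace (metric S) (f p) (phi_along S f p X) (dmap f p @` D p).

Definition totally_real_at (R : realType) (m n : nat) (N : manifold R m.*2.+1)
    (S : sasakian N) (M : manifold R n) (f : M -> N) (D : tangent_distr M)
    (p : M) : Prop :=
  forall X, D p X -> normal_vector S f p (phi_along S f p X).

Definition invariant_at (R : realType) (m n : nat) (N : manifold R m.*2.+1)
    (S : sasakian N) (M : manifold R n) (f : M -> N) (D : tangent_distr M)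
    (p : M) : Prop :=
  phi_along S f p @` D p = dmap f p @` D p.

Definition pointwise_slant_at (R : realType) (m n : nat)
    (N : manifold R m.*2.+1) (S : sasakian N) (M : manifold R n) (f : M -> N)
    (D : tangent_distr M) (p : M) : Prop :=
  exists theta : R, forall X, D p X -> X != 0 -> phi_angle S f D p X = theta.

Definition slant_on (R : realType) (m n : nat) (N : manifold R m.*2.+1)
    (S : sasakian N) (M : manifold R n) (f : M -> N) (D : tangent_distr M)
    (U : set M) : Prop :=
  exists theta : R, forall p X, U p -> D p X -> X != 0 ->
    phi_angle S f D p X = theta.

Definition constant_type_on (R : realType) (m n : nat)
    (N : manifold R m.*2.+1) (S : sasakian N) (M : manifold R n) (f : M -> N)
    (D : tangent_distr M) (U : set M) : Prop :=
  forall p q, U p -> U q ->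
    [/\ totally_real_at S f D p <-> totally_real_at S f D q,
        invariant_at S f D p <-> invariant_at S f D q
      & pointwise_slant_at S f D p <-> pointwise_slant_at S f D q].

Record proper_ptr_on (R : realType) (m n : nat) (N : manifold R m.*2.+1)
    (S : sasakian N) (M : manifold R n) (f : M -> N) (Dperp : tangent_distr M)
    (U : set M) : Prop := ProperPTR {
  proper_open : open U;
  proper_constant_type : constant_type_on S f (ambiguous S f Dperp) U;
  proper_not_totally_real :
    ~ (forall p, U p -> totally_real_at S f (ambiguous S f Dperp) p);
  proper_not_invariant :
    ~ (forall p, U p -> invariant_at S f (ambiguous S f Dperp) p);
  proper_not_slant : ~ slant_on S f (ambiguous S f Dperp) U;
  proper_not_pointwise_slant :
    ~ (forall p, U p -> pointwise_slant_at S f (ambiguous S f Dperp) p)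
}.

(* Main.v *)
Require Import Defs.
From HB Require Import structures.
From mathcomp Require Import all_boot all_order all_algebra.
From mathcomp Require Import all_classical all_reals all_analysis.
From mathcomp Require Import ring.

Set Implicit Arguments.
Unset Strict Implicit.
Unset Printing Implicit Defensive.

Import Defs Order.TTheory GRing.Theory Num.Theory.
Import numFieldNormedType.Exports.

Local Open Scope classical_set_scope.
Local Open Scope ring_scope.

(** The theorem rests on a classical fact: in a Sasakian manifold
    [eta] is a contact form with [d eta (u, v) = 2 g(u, phi v)], so a
    submanifold on which [eta] vanishes is isotropic for [g(., phi .)].

    The ambiguous distribution lies in [ker eta].  If it is integrable, then
    [eta] restricts to [0] on each of its integral manifolds; the exterior
    derivative commutes with restriction, so [g(X, phi Y) = 0] for all [X], [Y]
    in the ambiguous distribution ([ambiguous_phi_orthogonal]).  For [X]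
    ambiguous, [phi X] is moreover orthogonal to [xi], because [eta] kills the
    image of [phi], and to the chosen totally real distribution, because [phi]
    is skew and maps that distribution to normal vectors.  These three pieces
    span the tangent space, hence [phi X] is normal
    ([totally_real_ambiguous]), which is [P X = 0].  An ambiguous distribution
    that is totally real everywhere cannot be proper.

    Everything is computed at one point in coordinates.  A 1-form is written
    [x |-> a x] in the preferred chart of the point, and its exterior
    derivative there is [curl a].  That [curl] commutes with pullbacks
    ([curl_pullback]) is the symmetry of second derivatives ([derive2C]), and
    that charts do not matter is the chain rule ([diff_local_expr]).  The
    formula for [d eta] ([d_eta]) comes from the torsion-free metric connection
    evaluated on coordinate fields, whose brackets vanish, together with
    [nabla_u xi = - phi u] ([nabla_reeb]). *)

(** * Symmetry of second derivatives *)
Section Calculus.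
Context {R : realType}.

(** Differentials only see germs; this transfers differentiability and the value
    of the differential between the various expressions of a map that agree only
    where the charts involved are defined. *)
Lemma near_eq_is_diff (V W : normedModType R) (f g : V -> W) (x : V) :
  (\near x, f x = g x) -> differentiable f x -> is_diff x g ('d f x).
Proof.
move=> fg df.
have fgx : f x = g x by exact: nbhs_singleton fg.
have e : g \o shift x = cst (g x) + 'd f x +o_ 0 id.
  have /diff_locally fo := df.
  apply/eqaddoP => _/posnumP[e].
  have /eqaddoP /(_ e%:num) /(_ [gt0 of e%:num]) := fo.
  have fg0 : \forall y \near 0, f (y + x) = g (y + x).
    by have := fg; rewrite (near_shift 0 x); apply: filterS => y /=; rewrite subr0.
  rewrite !(near_simpl); apply: filter_app; near=> y.
  by rewrite /= /cst -fgx -[(f \o shift x + _) y]/(f (y + x) + _)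
    -[(g \o shift x + _) y]/(g (y + x) + _) (near fg0 y).
have c : continuous ('d f x) by exact: diff_continuous.
have de := diff_unique c e.
by split; [apply/diff_locallyP; rewrite de | exact: de].
Unshelve. all: by end_near. Qed.

Lemma near_eq_continuous (V W : normedModType R) (f g : V -> W) (x : V) :
  (\near x, f x = g x) -> {for x, continuous f} -> {for x, continuous g}.
Proof.
move=> fg cf; rewrite /prop_for /continuous_at -(nbhs_singleton fg).
apply: cvg_trans cf; apply: near_eq_cvg.
by apply: filterS fg => y ->.
Qed.

Lemma line_is_derive (V W : normedModType R) (h : V -> W) (y u : V) (t : R) :
  derivable h (t *: u + y) u ->
  is_derive t 1 (fun s => h (s *: u + y)) ('D_u h (t *: u + y)).
Proof.
have e : (fun k : R => k^-1 *: (((fun s => h (s *: u + y)) \o shift t) (k *: 1)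
                        - h (t *: u + y))) =
  (fun k => k^-1 *: ((h \o shift (t *: u + y)) (k *: u) - h (t *: u + y))).
  by apply/funext => k /=; rewrite addrA -scalerDl [k *: 1]mulr1.
by move=> dh; split; rewrite /derivable /derive e.
Qed.

(** Both orders of differentiation compute the same second difference: the mean
    value theorem is applied to the increment along [v] as a function of the
    parameter along [u], and then to ['D_u h] along [v].  The square
    [[0, s] x [0, s]] is the only place where [h] is evaluated. *)
Lemma second_difference_mean (V : normedModType R) (h : V -> R) (U : set V)
    (x u v : V) (s : R) :
  0 < s ->
  (forall a b, 0 <= a <= s -> 0 <= b <= s -> U (b *: v + (a *: u + x))) ->
  (forall y, U y -> derivable h y u) ->
  (forall y, U y -> derivable ('D_u h) y v) ->
  exists a b, [/\ 0 <= a <= s, 0 <= b <= s &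
    h (s *: v + (s *: u + x)) - h (s *: u + x) - (h (s *: v + x) - h x)
    = 'D_v ('D_u h) (b *: v + (a *: u + x)) * s * s].
Proof.
move=> s0 sU dh ddh.
have s00 : 0 <= s <= s by rewrite lexx ltW.
have s000 : 0 <= (0:R) <= s by rewrite lexx ltW.
pose p a := h (a *: u + (s *: v + x)) - h (a *: u + x).
have dp a : 0 <= a <= s ->
    is_derive a 1 p ('D_u h (a *: u + (s *: v + x)) - 'D_u h (a *: u + x)).
  move=> ha; apply: is_deriveB; apply: line_is_derive; apply: dh.
    by rewrite addrCA; exact: sU.
  by have := sU a 0 ha s000; rewrite scale0r add0r.
have mean (f df : R -> R) :
    (forall a, 0 <= a <= s -> is_derive a 1 f (df a)) ->
    exists2 c, 0 <= c <= s & f s - f 0 = df c * (s - 0).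
  move=> hf; apply: MVT_segment (ltW s0) _ _ => [a|].
    by rewrite in_itv /= => /andP[/ltW a0 /ltW as_]; apply: hf; rewrite a0.
  apply: derivable_within_continuous => a; rewrite in_itv /= => ha.
  by have [] := hf _ ha.
have [a ha pa] : exists2 a, 0 <= a <= s & p s - p 0
    = ('D_u h (a *: u + (s *: v + x)) - 'D_u h (a *: u + x)) * (s - 0).
  exact: mean _ _ dp.
have dq b : 0 <= b <= s ->
    is_derive b 1 (fun b => 'D_u h (b *: v + (a *: u + x)))
      ('D_v ('D_u h) (b *: v + (a *: u + x))).
  by move=> hb; apply: line_is_derive; apply: ddh; exact: sU.
have [b hb qb] := mean _ _ dq.
exists a, b; split => //.
move: pa qb; rewrite /p !scale0r !add0r subr0 => pa qb.
by rewrite -qb [in RHS]addrCA -pa [s *: v + _]addrCA; ring.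
Qed.

(** At every scale [s] the two second derivatives, taken at two points of the
    same small square, are equal to the second difference divided by [s ^+ 2];
    continuity at [x] lets [s] tend to [0]. *)
Lemma derive2C (V : normedModType R) (h : V -> R) (U : set V) (x u v : V) :
  open U -> U x ->
  (forall y, U y -> derivable h y u /\ derivable h y v) ->
  (forall y, U y -> derivable ('D_u h) y v /\ derivable ('D_v h) y u) ->
  {for x, continuous ('D_v ('D_u h))} -> {for x, continuous ('D_u ('D_v h))} ->
  'D_v ('D_u h) x = 'D_u ('D_v h) x.
Proof.
move=> oU Ux dh ddh c1 c2.
apply/eqP; rewrite -subr_eq0 -normr_le0; apply/ler_addgt0Pl => e e0; rewrite addr0.
have e20 : 0 < e / 2 by rewrite divr_gt0.
have near_x : \forall y \near x, [/\ U y,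
    `|'D_v ('D_u h) x - 'D_v ('D_u h) y| < e / 2 &
    `|'D_u ('D_v h) x - 'D_u ('D_v h) y| < e / 2].
  have h1 : \forall y \near x, `|'D_v ('D_u h) x - 'D_v ('D_u h) y| < e / 2.
    by move/cvgrPdist_lt : c1 => /(_ _ e20).
  have h2 : \forall y \near x, `|'D_u ('D_v h) x - 'D_u ('D_v h) y| < e / 2.
    by move/cvgrPdist_lt : c2 => /(_ _ e20).
  have h3 : \forall y \near x, U y by apply: open_nbhs_nbhs; split.
  by apply: filterS3 h3 h1 h2 => y; split.
have /nbhs_normP[d /= d0 hd] := near_x.
(* With this [s] the whole square of side [s] stays inside the ball of radius
   [d]; the summand 1 keeps the denominator positive when [u = v = 0]. *)
pose s := d / 2 / (`|u| + `|v| + 1).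
have n0 : 0 < `|u| + `|v| + 1 by rewrite ltr_wpDl // addr_ge0.
have s0 : 0 < s by rewrite !divr_gt0.
have sB a b : 0 <= a <= s -> 0 <= b <= s -> `|x - (b *: v + (a *: u + x))| < d.
  move=> /andP[a0 as_] /andP[b0 bs].
  have -> : x - (b *: v + (a *: u + x)) = - (b *: v + a *: u).
    by rewrite !opprD addrCA [x + _]addrCA subrr addr0.
  rewrite normrN (le_lt_trans (ler_normD _ _)) // !normrZ !ger0_norm //.
  apply: (@le_lt_trans _ _ (s * (`|u| + `|v| + 1))).
    rewrite !mulrDr mulr1 [s * _ + _]addrC.
    by rewrite -[leLHS]addr0 lerD ?(ltW s0) // lerD // ler_wpM2r.
  by rewrite /s divfK ?gt_eqF // ltr_pdivrMr // ltr_pMr ?ltr1n.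
have [a [b [ha hb E1]]] := @second_difference_mean _ h U x u v s s0
  (fun a b ha hb => let: And3 k _ _ := hd _ (sB a b ha hb) in k)
  (fun y Uy => (dh y Uy).1) (fun y Uy => (ddh y Uy).1).
have sB' a' b' : 0 <= a' <= s -> 0 <= b' <= s ->
    `|x - (b' *: u + (a' *: v + x))| < d.
  by move=> *; rewrite addrCA; exact: sB.
have [b' [a' [hb' ha' E2]]] := @second_difference_mean _ h U x v u s s0
  (fun a b ha hb => let: And3 k _ _ := hd _ (sB' a b ha hb) in k)
  (fun y Uy => (dh y Uy).2) (fun y Uy => (ddh y Uy).2).
have E : 'D_v ('D_u h) (b *: v + (a *: u + x)) = 'D_u ('D_v h) (a' *: u + (b' *: v + x)).
  apply: (mulIf (lt0r_neq0 s0)); apply: (mulIf (lt0r_neq0 s0)).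
  apply: etrans (esym E1) (etrans _ E2).
  rewrite [s *: v + (s *: u + x)]addrCA; set p := h _; set q := h _.
  set r := h _; set t := h _; rewrite !opprB !addrA [LHS]addrAC [RHS]addrAC.
  by congr (_ + t); rewrite addrAC.
have [_ k1 _] := hd _ (sB a b ha hb).
have [_ _ k2] := hd _ (sB' b' a' hb' ha').
rewrite E in k1.
rewrite -(subrKA ('D_u ('D_v h) (a' *: u + (b' *: v + x)))).
apply: (le_trans (ler_normD _ _)); apply: ltW.
rewrite [ltRHS]splitr; apply: ltrD; first exact: k1.
by rewrite distrC; exact: k2.
Qed.

End Calculus.

(** * Pullback and exterior derivative of 1-forms on R^n *)

Section Forms.
Context {R : realType}.

Lemma coord_is_derive (V : normedModType R) (n : nat) (h : V -> 'rV[R]_n) (x v : V) j :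
  derivable h x v -> is_derive x v (fun y => h y 0 j) (('D_v h x) 0 j).
Proof.
move=> dh; split; first by have /derivable_mxP := dh; apply.
by rewrite (derive_mx dh) mxE.
Qed.

Lemma derive2C_rV (k n : nat) (h : 'rV[R]_k -> 'rV[R]_n) (U : set 'rV[R]_k) x u v :
  open U -> U x -> Ck 2 U h -> 'D_v ('D_u h) x = 'D_u ('D_v h) x.
Proof.
move=> oU Ux [dh dDh].
have nU y : U y -> \forall z \near y, U z by move=> Uy; apply: open_nbhs_nbhs; split.
have D1 w y j : U y -> is_derive y w (fun z => h z 0 j) (('D_w h y) 0 j).
  by move=> Uy; apply: coord_is_derive; exact/diff_derivable/dh.
have E1 w y j : U y -> \forall z \near y, 'D_w h z 0 j = 'D_w (fun z => h z 0 j) z.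
  move=> Uy; apply: filterS (nU _ Uy) => z Uz.
  by have [_ ->] := D1 w z j Uz.
have D2 w w' y j : U y -> is_derive y w' ('D_w (fun z => h z 0 j)) (('D_w' ('D_w h) y) 0 j).
  move=> Uy; apply: near_eq_is_derive (E1 _ _ _ Uy) _.
  by apply: coord_is_derive; exact/diff_derivable/(dDh w).1.
have C2 w w' j : {for x, continuous ('D_w' ('D_w (fun z => h z 0 j)))}.
  have c : {for x, continuous ('D_w' ('D_w h))} by exact: ((dDh w).2 w').
  have c' : {for x, continuous (fun y => ('D_w' ('D_w h) y) 0 j)}.
    apply: (@continuous_comp _ _ _ ('D_w' ('D_w h)) (fun M => M 0 j)) => //.
    exact: matrix_normedtype.coord_continuous.
  apply: near_eq_continuous c'; apply: filterS (nU _ Ux) => y Uy.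
  by have [_ ->] := D2 w w' y j Uy.
apply/rowP => j.
apply: etrans (esym (@derive_val _ _ _ _ _ _ _ (D2 u v x j Ux))) _.
apply: etrans _ (@derive_val _ _ _ _ _ _ _ (D2 v u x j Ux)).
apply: (@derive2C _ _ _ U) => //.
- by move=> y Uy; split; [have [] := D1 u y j Uy|have [] := D1 v y j Uy].
- by move=> y Uy; split; [have [] := D2 u v y j Uy|have [] := D2 v u y j Uy].
Qed.

(** The pairing of a 1-form, given by its coefficients, with a vector. *)
Definition dot (n : nat) (a v : 'rV[R]_n) : R := \sum_j a 0 j * v 0 j.

Lemma dotE n (a v : 'rV[R]_n) : dot a v = (a *m v^T) 0 0.
Proof. by rewrite mxE; apply: eq_bigr => j _; rewrite mxE. Qed.

Lemma dot_linear n (a : 'rV[R]_n) : scalar (dot a).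
Proof. by move=> c u v; rewrite !dotE linearD linearZ /= mulmxDr -scalemxAr !mxE. Qed.

HB.instance Definition _ n (a : 'rV[R]_n) :=
  GRing.isLinear.Build R 'rV[R]_n R *%R (dot a) (dot_linear a).

Lemma dot_delta n (a : 'rV[R]_n) j : dot a (delta_mx 0 j) = a 0 j.
Proof.
rewrite /dot (bigD1 j) //= mxE !eqxx mulr1 big1 ?addr0 // => i ij.
by rewrite mxE eqxx (negPf ij) mulr0.
Qed.

Lemma dot_is_derive (V : normedModType R) n (f g : V -> 'rV[R]_n) x v :
  derivable f x v -> derivable g x v ->
  is_derive x v (fun y => dot (f y) (g y)) (dot ('D_v f x) (g x) + dot (f x) ('D_v g x)).
Proof.
move=> df dg; rewrite {2 3}/dot -big_split /=.
have e : (fun y => \sum_j f y 0 j * g y 0 j) =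
  (\sum_(j < n) ((fun y => f y 0 j) * (fun y => g y 0 j))).
  by apply/funext => y; rewrite fct_sumE.
rewrite e; apply: is_derive_eq.
  apply: is_derive_sum => j; apply: is_deriveM; exact: coord_is_derive.
by apply: eq_bigr => j _ /=; rewrite addrC; congr (_ + _); rewrite -[LHS]mulrC.
Qed.

Lemma differentiable_coord_comp (V : normedModType R) n (f : V -> 'rV[R]_n) x j :
  differentiable f x -> differentiable (fun y => f y 0 j) x.
Proof.
move=> df; apply: (@differentiable_comp _ _ _ _ f (fun M : 'rV[R]_n => M 0 j)) => //.
exact: differentiable_coord.
Qed.

Lemma differentiable_rV (V : normedModType R) n (f : V -> 'rV[R]_n) x :
  (forall j, differentiable (fun y => f y 0 j) x) -> differentiable f x.
Proof.
move=> df.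
have -> : f = \sum_(j < n) (fun y => f y 0 j *: delta_mx 0 j).
  by apply/funext => y; rewrite fct_sumE [LHS]row_sum_delta.
by apply: differentiable_sum => j; exact: differentiableZl.
Qed.

Lemma differentiable_dot (V : normedModType R) n (f g : V -> 'rV[R]_n) x :
  differentiable f x -> differentiable g x ->
  differentiable (fun y => dot (f y) (g y)) x.
Proof.
move=> df dg; rewrite /dot.
have -> : (fun y => \sum_j f y 0 j * g y 0 j) =
  (\sum_(j < n) ((fun y => f y 0 j) * (fun y => g y 0 j))).
  by apply/funext => y; rewrite fct_sumE.
apply: differentiable_sum => j; apply: differentiableM; exact: differentiable_coord_comp.
Qed.

(** The exterior derivative of [\sum_j a_j dx_j], evaluated on [(u, v)]. *)
Definition curl n (a : 'rV[R]_n -> 'rV[R]_n) (x u v : 'rV[R]_n) : R :=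
  dot ('d a x u) v - dot ('d a x v) u.

Definition pullback k n (h : 'rV[R]_k -> 'rV[R]_n) (a : 'rV[R]_n -> 'rV[R]_n) :
    'rV[R]_k -> 'rV[R]_k :=
  fun x => \row_j dot (a (h x)) ('d h x (delta_mx 0 j)).

Lemma dot_pullback k n (h : 'rV[R]_k -> 'rV[R]_n) a x w :
  dot (pullback h a x) w = dot (a (h x)) ('d h x w).
Proof.
rewrite [w in RHS]row_sum_delta !linear_sum.
by apply: eq_bigr => j _; rewrite mxE linearZ linearZ mulrC.
Qed.

Lemma diff_dot (V : normedModType R) n (a : V -> 'rV[R]_n) (x w : V) w' :
  differentiable a x ->
  'd (fun z => dot (a z) w') x w = dot ('d a x w) w'.
Proof.
move=> da.
have d : differentiable (fun z => dot (a z) w') x.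
  by apply: differentiable_dot => //; exact: differentiable_cst.
rewrite -(@deriveE _ _ _ _ _ w d).
have [_ ->] := dot_is_derive (@diff_derivable _ _ _ _ _ w da)
  (@derivable_cst _ _ _ w' x w).
by rewrite derive_cst linear0 addr0 (@deriveE _ _ _ _ _ w da).
Qed.

(** Differentiating [a(h x) . D_v h x] along [u] gives the wanted term plus
    [a(h x) . D_u D_v h x], which is symmetric in [u] and [v] and hence
    disappears in [curl]. *)
Lemma curl_pullback k n (h : 'rV[R]_k -> 'rV[R]_n) a (U : set 'rV[R]_k) x u v :
  open U -> U x -> Ck 2 U h -> differentiable a (h x) ->
  differentiable (pullback h a) x /\
  curl (pullback h a) x u v = curl a (h x) ('d h x u) ('d h x v).
Proof.
move=> oU Ux Ch da.
have [dh dDh] := Ch.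
have nU : \forall z \near x, U z by apply: open_nbhs_nbhs; split.
have dah : differentiable (a \o h) x by apply: differentiable_comp => //; exact: dh.
have eD w : \forall z \near x, dot (a (h z)) ('D_w h z) = dot (pullback h a z) w.
  by apply: filterS nU => z Uz; rewrite dot_pullback deriveE //; exact: dh.
have dD w : differentiable (fun z => dot (a (h z)) ('D_w h z)) x.
  by apply: differentiable_dot => //; exact: (dDh w).1.
have dp : differentiable (pullback h a) x.
  apply: differentiable_rV => j.
  have := near_eq_is_diff (eD (delta_mx 0 j)) (dD _).
  by under [X in is_diff x X]eq_fun do rewrite dot_delta; case.
split=> //.
have key w w' : dot ('d (pullback h a) x w) w' =
    dot ('d a (h x) ('d h x w)) ('d h x w') + dot (a (h x)) ('D_w ('D_w' h) x).
  have dpw : differentiable (fun z => dot (pullback h a z) w') x.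
    by apply: differentiable_dot => //; exact: differentiable_cst.
  rewrite -(diff_dot w w' dp) -(@deriveE _ _ _ _ _ w dpw).
  rewrite -(near_eq_derive w (eD w')).
  have dah_w : 'D_w (a \o h) x = 'd a (h x) ('d h x w).
    rewrite (@deriveE _ _ _ _ _ w dah).
    exact: (congr1 (@^~ w) (diff_comp (dh x Ux) da)).
  have [_ ->] := dot_is_derive (@diff_derivable _ _ _ _ _ w dah)
    (@diff_derivable _ _ _ _ _ w ((dDh w').1 x Ux)).
  by rewrite dah_w (@deriveE _ _ _ _ _ w' (dh x Ux)).
by rewrite /curl !key (derive2C_rV u v oU Ux Ch) opprD addrACA subrr addr0.
Qed.

End Forms.

(** * 1-forms in charts *)

Section Geometry.
Context {R : realType}.

Lemma diff_near_eq (V W : normedModType R) (f g : V -> W) (x : V) :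
  (\near x, f x = g x) -> differentiable f x -> forall v, 'd g x v = 'd f x v.
Proof. by move=> fg df v; have [_ ->] := near_eq_is_diff fg df. Qed.

Lemma diff_compE (U V W : normedModType R) (f : U -> V) (g : V -> W) (x v : U) :
  differentiable f x -> differentiable g (f x) ->
  'd (g \o f) x v = 'd g (f x) ('d f x v).
Proof. by move=> df dg; rewrite diff_comp. Qed.

Lemma diff_idE (V : normedModType R) (x v : V) : 'd (@id V) x v = v.
Proof. by have [_ ->] := is_diff_id x. Qed.

Lemma Ck_eq_on (n k : nat) (V : normedModType R) (U : set 'rV[R]_n)
    (h h' : 'rV[R]_n -> V) :
  open U -> (forall x, U x -> h x = h' x) -> Ck k U h -> Ck k U h'.
Proof.
move=> oU; have nU y : U y -> \forall z \near y, U z.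
  by move=> Uy; apply: open_nbhs_nbhs; split.
elim: k h h' => [|k IH] h h' e /=.
  move=> ch x Ux; apply: near_eq_continuous (ch x Ux).
  by apply: filterS (nU _ Ux) => y Uy; exact: e.
have ne x : U x -> \near x, h x = h' x.
  by move=> Ux; apply: filterS (nU _ Ux) => y Uy; exact: e.
case=> dh DDh; split => [x Ux|v].
  by have [] := near_eq_is_diff (ne x Ux) (dh x Ux).
apply: IH (DDh v) => x Ux.
exact: near_eq_derive (ne x Ux).
Qed.

Lemma Ck_cst (n k : nat) (V : normedModType R) (U : set 'rV[R]_n) (c : V) :
  Ck k U (fun=> c).
Proof.
elim: k c => [|k IH] c /=; first by move=> x _; exact: cst_continuous.
split=> [x _|v]; first exact: differentiable_cst.
have -> : (fun x : 'rV[R]_n => 'D_v (fun=> c) x) = fun=> 0.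
  by apply/funext => x; exact: derive_cst.
exact: IH.
Qed.

Section Charts.
Context (n : nat) (M : manifold R n).
Implicit Types p q z : M.

Notation domp p := (dom (chart_at p)).
Notation im p := (coord (chart_at p) @` dom (chart_at p)).

Lemma near_dom p q : domp p q -> \forall z \near q, domp p z.
Proof. by move=> dq; apply: open_nbhs_nbhs; split => //; exact: dom_open. Qed.

Lemma near_image p q : domp p q -> \forall x \near coord_at p q, im p x.
Proof.
move=> dq; apply: open_nbhs_nbhs; split; first exact: image_open.
by exists q.
Qed.

Lemma coord_atK p q : domp p q -> para_at p (coord_at p q) = q.
Proof. exact: coordK. Qed.

Lemma para_image p x : im p x -> domp p (para_at p x) /\ coord_at p (para_at p x) = x.
Proof. by move=> [z dz <-]; rewrite /para_at /coord_at coordK. Qed.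

(** Properties that hold near a point of the manifold are transported to the
    model space, where derivatives are taken. *)
Lemma near_para p q (P : M -> Prop) : domp p q ->
  (\forall z \near q, P z) -> \forall x \near coord_at p q, P (para_at p x).
Proof.
move=> dq nP.
have c : {for coord_at p q, continuous (para_at p)}.
  by apply: para_continuous; exists q.
by move: nP; rewrite -{1}(coordK dq) => nP; exact: c nP.
Qed.

Lemma differentiable_transition p q z : domp p z -> domp q z ->
  differentiable (coord_at q \o para_at p) (coord_at p z).
Proof.
move=> dp dq; have [d _] := chart_at_compat p q 1%N.
by apply: d; exists z.
Qed.

(** Transition maps are mutually inverse near [z], so the chain rule makes their
    differentials inverse to each other. *)
Lemma transitionK p q z v : domp p z -> domp q z ->
  'd (coord_at q \o para_at p) (coord_at p z)
    ('d (coord_at p \o para_at q) (coord_at q z) v) = v.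
Proof.
move=> dp dq.
have e : (coord_at p \o para_at q) (coord_at q z) = coord_at p z.
  by rewrite /= coord_atK.
have d1 := differentiable_transition dq dp.
have d2 : differentiable (coord_at q \o para_at p)
   ((coord_at p \o para_at q) (coord_at q z)).
  by rewrite e; exact: differentiable_transition.
rewrite -e -(diff_compE v d1 d2) -[RHS](diff_idE (coord_at q z)).
apply: diff_near_eq; last by have [] := is_diff_id (coord_at q z).
have n1 : \forall x \near coord_at q z, domp p (para_at q x).
  exact: near_para (near_dom _).
have n2 := near_image dq.
apply: filterS2 n1 n2 => x h1 h2 /=.
rewrite coord_atK //.
by have [_ ->] := para_image h2.
Qed.

Lemma comp_in_id p v : comp_in p p v = v.
Proof.
rewrite /comp_in -[RHS](diff_idE (coord_at p p)).
apply: diff_near_eq; last by have [] := is_diff_id (coord_at p p).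
apply: filterS (near_image (chart_at_dom p)) => x h /=.
by have [_ ->] := para_image h.
Qed.

(** The vector field with constant components [v] in the chart at [p]: each
    value has to be converted to the preferred chart of the point where it is
    taken. *)
Definition coord_field p v : vfield M :=
  fun q => 'd (coord_at q \o para_at p) (coord_at p q) v.

Lemma comp_in_coord_field p q v : domp p q -> comp_in p q (coord_field p v q) = v.
Proof. by move=> dq; apply: transitionK => //; exact: chart_at_dom. Qed.

Lemma coord_field_comp_in p q v : domp p q -> coord_field p (comp_in p q v) q = v.
Proof. by move=> dq; apply: transitionK => //; exact: chart_at_dom. Qed.

Lemma coord_field_self p v : coord_field p v p = v.
Proof. exact: comp_in_id. Qed.

Lemma vfield_in_coord_field p v x : im p x -> vfield_in p (coord_field p v) x = v.
Proof. by move=> /para_image[dx _]; exact: comp_in_coord_field. Qed.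

Lemma smooth_coord_field p v : smooth_vfield_at p (coord_field p v).
Proof.
exists (im p); split; [exact: image_open|by exists p => //; exact: chart_at_dom|].
move=> k; apply: (Ck_eq_on _ _ (@Ck_cst _ k _ _ v)); first exact: image_open.
by move=> x ix; rewrite vfield_in_coord_field.
Qed.

Lemma lie_bracket_coord_field p u v :
  lie_bracket (coord_field p u) (coord_field p v) p = 0.
Proof.
have d0 w w' : 'd (vfield_in p (coord_field p w)) (coord_at p p) w' = 0.
  transitivity ('d (fun _ : 'rV[R]_n => w) (coord_at p p) w'); last first.
    by rewrite diff_cst.
  apply: diff_near_eq; last exact: differentiable_cst.
  apply: filterS (near_image (chart_at_dom p)) => x h.
  by rewrite vfield_in_coord_field.
exact: etrans (congr2 (fun a b => a - b) (d0 v _) (d0 u _)) (subrr 0).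
Qed.

Lemma smooth_vfield0 p : smooth_vfield_at p (fun _ : M => 0).
Proof.
exists (im p); split; [exact: image_open|by exists p => //; exact: chart_at_dom|].
move=> k; apply: (Ck_eq_on _ _ (@Ck_cst _ k _ _ 0)); first exact: image_open.
by move=> x ix; rewrite /vfield_in /comp_in linear0.
Qed.

Lemma smooth_near_differentiable (V : normedModType R) x (h : 'rV[R]_n -> V) :
  smooth_near x h -> differentiable h x.
Proof. by move=> [U [_ Ux /(_ 1%N)[d _]]]; exact: d. Qed.

(** [a] gives the coefficients, in the chart at [p], of the 1-form [alpha], whose
    values at [q] are taken on components in the chart at [q]. *)
Definition represents (alpha : M -> 'rV[R]_n -> R) p
    (a : 'rV[R]_n -> 'rV[R]_n) : Prop :=
  \forall q \near p, forall v, alpha q v = dot (a (coord_at p q)) (comp_in p q v).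

(** The coefficients of a form are unique, since every vector is [comp_in p q v]
    for some [v]; those of the zero form vanish near the point, and so do their
    derivatives. *)
Lemma represents0_curl (alpha : M -> 'rV[R]_n -> R) p a u v :
  (forall q w, alpha q w = 0) -> represents alpha p a ->
  curl a (coord_at p p) u v = 0.
Proof.
move=> a0 ra.
have na : \forall x \near coord_at p p, 0 = a x.
  have n1 := near_para (chart_at_dom p) ra.
  have n2 := near_image (chart_at_dom p).
  apply: filterS2 n1 n2 => x h1 h2.
  have [dx ex] := para_image h2.
  apply/rowP => j; rewrite mxE -dot_delta -[delta_mx 0 j](comp_in_coord_field _ dx).
  by rewrite -[x in a x]ex -h1 a0.
have d0 w : 'd a (coord_at p p) w = 0.
  rewrite (diff_near_eq na); first by rewrite diff_cst.
  exact: differentiable_cst.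
have dot0 w : dot (0 : 'rV[R]_n) w = 0.
  by rewrite /dot big1 // => j _; rewrite mxE mul0r.
by rewrite /curl !d0 !dot0 subrr.
Qed.

End Charts.

Lemma near_differentiable_local_expr k n (M : manifold R k) (N : manifold R n)
    (f : M -> N) p :
  smooth_map f ->
  \forall q \near p, differentiable (local_expr f p) (coord_at p q).
Proof.
move=> [_ /(_ p)[U [oU Up sU]]].
have c : {for p, continuous (coord_at p)}.
  by apply: coord_continuous; exact: chart_at_dom.
have nU : \forall x \near coord_at p p, U x by apply: open_nbhs_nbhs; split.
have {}nU : \forall q \near p, U (coord_at p q) by exact: c nU.
by apply: filterS nU => q Uq; have [d _] := sU 1%N; exact: d.
Qed.

(** Both sides differentiate [coord_at (f p) \o f \o para_at q], once factored
    through the chart at [p] and once through the chart at [f q]. *)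
Lemma diff_local_expr k n (M : manifold R k) (N : manifold R n)
    (f : M -> N) p q v :
  smooth_map f -> dom (chart_at p) q -> dom (chart_at (f p)) (f q) ->
  differentiable (local_expr f p) (coord_at p q) ->
  'd (local_expr f p) (coord_at p q) (comp_in p q v)
    = comp_in (f p) (f q) (dmap f q v).
Proof.
move=> sf dq dfq d1.
have [cf _] := sf.
have dqq : dom (chart_at q) q by exact: chart_at_dom.
have dfqq : dom (chart_at (f q)) (f q) by exact: chart_at_dom.
have t1 := differentiable_transition dqq dq.
have t2 := differentiable_transition dfqq dfq.
have d2 : differentiable (local_expr f q) (coord_at q q).
  by apply: smooth_near_differentiable; exact: sf.2.
have e1 : (coord_at p \o para_at q) (coord_at q q) = coord_at p q.
  by rewrite /= coord_atK.
have e2 : local_expr f q (coord_at q q) = coord_at (f q) (f q).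
  by rewrite /local_expr /= coord_atK.
rewrite -e1 in d1; rewrite -e2 in t2.
rewrite /comp_in /dmap -e1 -e2.
apply: etrans (esym (diff_compE v t1 d1)) _.
apply: etrans _ (diff_compE v d2 t2).
apply: diff_near_eq; last exact: differentiable_comp d2 t2.
have n1 : \forall x \near coord_at q q, dom (chart_at p) (para_at q x).
  by apply: near_para => //; exact: near_dom.
have n2 : \forall x \near coord_at q q, dom (chart_at (f q)) (f (para_at q x)).
  apply: (near_para dqq (P := fun z => dom (chart_at (f q)) (f z))).
  exact: cf _ _ (near_dom dfqq).
apply: filterS2 n1 n2 => x h1 h2.
by rewrite /local_expr /= !coord_atK.
Qed.

Lemma represents_pullback k n (M : manifold R k) (N : manifold R n)
    (f : M -> N) p (alpha : N -> 'rV[R]_n -> R) a :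
  smooth_map f -> represents alpha (f p) a ->
  represents (fun q v => alpha (f q) (dmap f q v)) p
    (pullback (local_expr f p) a).
Proof.
move=> sf ra.
have n1 := near_differentiable_local_expr p sf.
have n2 := near_dom (chart_at_dom p).
have n3 : \forall q \near p, dom (chart_at (f p)) (f q).
  exact: sf.1 _ _ (near_dom (chart_at_dom (f p))).
have n4 : \forall q \near p, forall v, alpha (f q) v
    = dot (a (coord_at (f p) (f q))) (comp_in (f p) (f q) v).
  exact: sf.1 _ _ ra.
apply: filterS (filterI (filterI n1 n2) (filterI n3 n4)) => q [[h1 h2] [h3 h4]] v.
rewrite h4 dot_pullback (diff_local_expr v sf h2 h3 h1); congr (dot (a _) _).
by rewrite /local_expr /= coord_atK.
Qed.

Lemma curl_pullback_local_expr k n (M : manifold R k) (N : manifold R n)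
    (f : M -> N) p a u v :
  smooth_map f -> differentiable a (coord_at (f p) (f p)) ->
  differentiable (pullback (local_expr f p) a) (coord_at p p) /\
  curl (pullback (local_expr f p) a) (coord_at p p) u v
    = curl a (coord_at (f p) (f p)) (dmap f p u) (dmap f p v).
Proof.
move=> [_ /(_ p)[U [oU Up sU]]].
have <- : local_expr f p (coord_at p p) = coord_at (f p) (f p).
  by rewrite /local_expr /= coord_atK //; exact: chart_at_dom.
by move=> da; exact: curl_pullback (sU 2%N) da.
Qed.

End Geometry.

(** * Orthogonal projection *)

Section Metric.
Context {R : realType} (n : nat) (M : manifold R n) (g : metric_field M).
Context (gP : riemannian_metric g).
Implicit Types (p : M) (u v w : 'rV[R]_n) (c : R).

Lemma metricDl p u v w : g p (u + v) w = g p u w + g p v w.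
Proof. by have /= := metric_linear gP p w 1 u v; rewrite scale1r mul1r. Qed.

Lemma metric0l p w : g p 0 w = 0.
Proof. by apply: (addrI (g p 0 w)); rewrite -metricDl !addr0. Qed.

Lemma metricZl p c u w : g p (c *: u) w = c * g p u w.
Proof. by have /= := metric_linear gP p w c u 0; rewrite metric0l !addr0. Qed.

Lemma metricNl p u w : g p (- u) w = - g p u w.
Proof. by rewrite -scaleN1r metricZl mulN1r. Qed.

Lemma metricDr p u v w : g p w (u + v) = g p w u + g p w v.
Proof. by rewrite !(metric_sym gP p w) metricDl. Qed.

Lemma metricZr p c u w : g p w (c *: u) = c * g p w u.
Proof. by rewrite !(metric_sym gP p w) metricZl. Qed.

Lemma metricNr p u w : g p w (- u) = - g p w u.
Proof. by rewrite !(metric_sym gP p w) metricNl. Qed.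

Lemma metric0r p w : g p w 0 = 0.
Proof. by rewrite (metric_sym gP) metric0l. Qed.

Lemma metric_eq0 p u : g p u u = 0 -> u = 0.
Proof.
by move=> gu; apply/eqP/negPn/negP => /(metric_pos gP p); rewrite gu ltxx.
Qed.

(** The Gram matrix of independent rows is invertible by positivity, so the
    normal equations have a solution. *)
Lemma orthogonal_projection p r (E : 'M[R]_(r, n)) u : row_free E ->
  exists c : 'rV[R]_r, forall w, (w <= E)%MS -> g p (u - c *m E) w = 0.
Proof.
move=> fE.
pose G : 'M[R]_r := \matrix_(i, j) g p (row i E) (row j E).
have gE (c : 'rV[R]_r) w : g p (c *m E) w = \sum_i c 0 i * g p (row i E) w.
  rewrite mulmx_sum_row.
  elim/big_rec2: _ => [|i y z _ <-]; first exact: metric0l.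
  by rewrite metricDl metricZl.
have GE (c : 'rV[R]_r) j : (c *m G) 0 j = g p (c *m E) (row j E).
  by rewrite mxE gE; apply: eq_bigr => i _; rewrite mxE.
have uG : G \in unitmx.
  rewrite -row_free_unit; apply/inj_row_free => c cG.
  have : g p (c *m E) (c *m E) = 0.
    rewrite gE big1 // => i _.
    by rewrite (metric_sym gP) -GE cG mxE mulr0.
  by move=> /metric_eq0 cE; apply: (row_free_inj fE); rewrite cE mul0mx.
exists ((\row_j g p u (row j E)) *m invmx G) => w /submxP[d ->].
rewrite (metric_sym gP) gE big1 // => j _.
rewrite (metric_sym gP) metricDl metricNl -GE mulmxKV // mxE subrr.
exact: mulr0.
Qed.

End Metric.

(** * The contact form of a Sasakian manifold *)

Section Sasaki.
Context {R : realType} (m : nat) (N : manifold R m.*2.+1) (S : sasakian N).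
Local Notation g := (metric S).
Local Notation gP := (metricP S).
Local Notation xi := (reeb S).
Implicit Types (p : N) (u v w : 'rV[R]_(m.*2.+1)).

Lemma etaE p u : eta S p u = g p u (xi p).
Proof.
have := metric_phi S p u (xi p).
rewrite phi_reeb (metric0r gP) eta_reeb mulr1 => /esym/eqP.
by rewrite subr_eq0 => /eqP.
Qed.

Lemma eta_phi p u : eta S p (phi S p u) = 0.
Proof.
have := congr1 (phi S p) (phi_sq S p u).
rewrite phi_sq linearD linearN linearZ /= phi_reeb scaler0 => e.
have h := addrI _ e.
have := congr1 (eta S p) h; rewrite linearZ /= eta_reeb linear0.
by rewrite /GRing.scale /= mulr1.
Qed.

Lemma metric_phi_skew p u v : g p (phi S p u) v = - g p u (phi S p v).
Proof.
have := metric_phi S p u (phi S p v).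
rewrite eta_phi mulr0 subr0 phi_sq (metricDr gP) (metricNr gP) (metricZr gP).
by rewrite -etaE eta_phi mulr0 addr0 => <-; rewrite opprK.
Qed.

(** The structure equation for [nabla phi] applied to [xi], where [phi xi = 0],
    determines [phi (nabla_u xi)]; since [phi] is invertible only on [ker eta],
    the component of [nabla_u xi] along [xi] is found separately, from
    [g(xi, xi) = 1]. *)
Lemma nabla_reeb p u : conn S p u xi = - phi S p u.
Proof.
have LC := connP S; have AC := lc_connection LC.
have sxi := reeb_smooth S p.
have n0 : conn S p u (fun _ => 0) = 0.
  have := nabla_add AC u (@smooth_vfield0 R _ N p) (@smooth_vfield0 R _ N p).
  have -> : (fun q : N => 0 + 0) = (fun=> 0) :> vfield N.
    by apply/funext => q; rewrite addr0.
  by move=> /eqP; rewrite -subr_eq0 opprD addrA subrr sub0r oppr_eq0 => /eqP.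
have ph0 : phi S p (conn S p u xi) = u - eta S p u *: xi p.
  have := @nabla_phi _ _ _ S p u _ sxi.
  have -> : (fun q => phi S q (reeb S q)) = (fun=> 0) :> vfield N.
    by apply/funext => q; rewrite phi_reeb.
  rewrite n0 sub0r eta_reeb scale1r -etaE => /(congr1 -%R).
  by rewrite opprK opprB.
have eta0 : eta S p (conn S p u xi) = 0.
  have := lc_metric LC u sxi sxi.
  have -> : (fun q => metric S q (reeb S q) (reeb S q)) = (fun=> 1).
    by apply/funext => q; rewrite -etaE eta_reeb.
  rewrite /dfun (_ : (fun=> 1) \o para_at p = cst 1) // diff_cst /=.
  rewrite (metric_sym gP p (reeb S p)) -etaE -mulr2n => /esym/eqP.
  by rewrite mulrn_eq0 /= => /eqP.
have := phi_sq S p (conn S p u xi); rewrite eta0 scale0r addr0 ph0.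
rewrite linearB linearZ /= phi_reeb scaler0 subr0 => ->.
by rewrite opprK.
Qed.

(** By metric compatibility [u . eta(V) = g(nabla_u V, xi) + g(V, nabla_u xi)].
    For coordinate fields the first terms are symmetric in [u] and [v], as the
    torsion and the bracket vanish; the second ones are given by [nabla_reeb]
    and are skew. *)
Lemma d_eta p u v :
  dfun p (fun q => eta S q (coord_field p v q)) u
    - dfun p (fun q => eta S q (coord_field p u q)) v = 2 * g p u (phi S p v).
Proof.
have LC := connP S.
have sxi := reeb_smooth S p.
have su w := smooth_coord_field p w.
have D w w' : dfun p (fun q => eta S q (coord_field p w q)) w'
    = g p (conn S p w' (coord_field p w)) (xi p) + g p w' (phi S p w).
  have -> : (fun q => eta S q (coord_field p w q))
      = (fun q => metric S q (coord_field p w q) (xi q)).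
    by apply/funext => q; rewrite etaE.
  rewrite (lc_metric LC w' (su w) sxi) nabla_reeb coord_field_self.
  by rewrite (metricNr gP) -metric_phi_skew (metric_sym gP p w').
have := lc_torsion_free LC (su u) (su v).
rewrite lie_bracket_coord_field !coord_field_self => /eqP.
rewrite subr_eq0 => /eqP T.
rewrite !D T opprD addrACA subrr add0r.
by rewrite (metric_sym gP p v) metric_phi_skew opprK mulr2n mulrDl mul1r.
Qed.

Lemma eta_represented p : exists a,
  [/\ represents (fun q v => eta S q v) p a,
      differentiable a (coord_at p p) &
      forall u v, curl a (coord_at p p) u v = 2 * g p u (phi S p v)].
Proof.
pose A w := (fun q => eta S q (coord_field p w q)) \o para_at p.
pose a := fun x => \row_j A (delta_mx 0 j) x.
have Alin x : scalar (A^~ x).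
  by move=> c u v; rewrite /A /= /coord_field !linearP.
have aE x w : dot (a x) w = A w x.
  pose L := GRing.isLinear.Build _ _ _ _ _ (Alin x).
  pose AL : {linear _ -> _ | _} := HB.pack (A^~ x) L.
  rewrite -[RHS]/(AL w) [w in RHS]row_sum_delta linear_sum.
  by apply: eq_bigr => j _; rewrite mxE linearZ mulrC.
have dA w : differentiable (A w) (coord_at p p).
  apply: smooth_near_differentiable.
  exact: eta_smooth (smooth_coord_field p w).
have da : differentiable a (coord_at p p).
  apply: differentiable_rV => j.
  rewrite (_ : (fun y => a y 0 j) = A (delta_mx 0 j)) //.
  by apply/funext => x; rewrite mxE.
exists a; split => //.
  apply: filterS (near_dom (chart_at_dom p)) => q dq v.
  by rewrite aE /A /= coord_atK // coord_field_comp_in.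
move=> u v.
rewrite -d_eta /curl -!(diff_dot _ _ da).
by congr (_ - _); congr ('d _ _ _); apply/funext => x; rewrite aE.
Qed.

End Sasaki.

(** * Integrability of the ambiguous distribution *)

Section Submanifold.
Context {R : realType} (m n : nat) (N : manifold R m.*2.+1) (S : sasakian N).
Context (M : manifold R n) (f : M -> N).

(** The coefficients of [eta] are pulled back along [f] and then along [i]; the
    resulting form on [L] is zero, hence so is its [curl], which is
    [2 g(u, phi v)] on the images of [u] and [v].  Pulling back in two steps
    asks for the smoothness of [f] and of [i] only, not of the composite. *)
Lemma phi_orthogonal_of_eta0 k (L : manifold R k) (i : L -> M) l u v :
  smooth_map f -> smooth_map i ->
  (forall q w, eta S (f (i q)) (dmap f (i q) (dmap i q w)) = 0) ->
  metric S (f (i l)) (dmap f (i l) (dmap i l u))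
    (phi S (f (i l)) (dmap f (i l) (dmap i l v))) = 0.
Proof.
move=> sf si eta0.
have [a [ra da ca]] := eta_represented S (f (i l)).
have rb := represents_pullback sf ra.
have [db cb] := curl_pullback_local_expr (dmap i l u) (dmap i l v) sf da.
have rc := represents_pullback si rb.
have [_ cc] := curl_pullback_local_expr u v si db.
have := represents0_curl u v eta0 rc.
rewrite cc cb ca => /eqP; rewrite mulf_eq0 pnatr_eq0 /= => /eqP.
exact.
Qed.

Context (Dperp : tangent_distr M) (hM : ptr_submanifold S f Dperp).
Notation Damb := (ambiguous S f Dperp).

Lemma ambiguous_phi_orthogonal p X Y : integrable_distr Damb ->
  Damb p X -> Damb p Y ->
  metric S (f p) (dmap f p X) (phi S (f p) (dmap f p Y)) = 0.
Proof.
move=> /(_ p)[k [L [i [[[si _] _ Di] [l _ il]]]]].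
rewrite -il -Di => -[u _ <-] [v _ <-].
apply: phi_orthogonal_of_eta0 => //; first exact: (ptr_immersion hM).1.
move=> q w; have [_] : Damb (i q) (dmap i q w) by rewrite -Di; exists w.
by rewrite etaE.
Qed.

(** A tangent vector [Z] splits as [Z' + W + b xi] with [W] in the totally real
    distribution and [Z'] ambiguous, and [phi X] is orthogonal to each part. *)
Lemma totally_real_ambiguous p : integrable_distr Damb ->
  totally_real_at S f Damb p.
Proof.
move=> iD X DX Z; rewrite /phi_along.
have [_ inj] := ptr_immersion hM.
have [r _ /(_ p)[E [_ /nbhs_singleton [fE DE]]]] := ptr_distribution hM.
move: (E p) fE DE => {}E fE DE.
have [xi0 _ xi0E] := ptr_reeb_tangent hM p.
pose df := 'd (local_expr f p) (coord_at p p).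
(* The projection is carried out in the ambient tangent space, where the metric
   lives: [E'] is the image under [df] of the frame [E]. *)
pose E' := E *m lin1_mx df.
have cE' (c : 'rV[R]_r) : c *m E' = dmap f p (c *m E).
  by rewrite mulmxA mul_rV_lin1.
have fE' : row_free E'.
  apply/inj_row_free => c; rewrite cE' => cE.
  apply: (row_free_inj fE); rewrite mul0mx; apply: (inj p).
  by rewrite cE /dmap linear0.
have [c cP] := orthogonal_projection (metricP S) (f p) (dmap f p Z) fE'.
pose W := c *m E.
have DW : Dperp p W by rewrite DE /=; exact: submxMl.
pose b := eta S (f p) (dmap f p Z).
pose Z' := Z - W - b *: xi0.
have dZ' : dmap f p Z' = dmap f p Z - dmap f p W - b *: reeb S (f p).
  by rewrite -xi0E /dmap !linearB linearZ.
have DZ' : Damb p Z'.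
  split => [V DV|].
    rewrite /induced_metric dZ' (metricDl (metricP S)) (metricNl (metricP S)).
    rewrite (metricZl (metricP S)) (metric_sym (metricP S) _ (reeb _ _)) -etaE.
    rewrite (ptr_ker_eta hM DV) mulr0 subr0 -cE'; apply: cP.
    have [d ->] : exists d, V = d *m E.
      by move: DV; rewrite DE => /submxP.
    by rewrite -cE' submxMl.
  by rewrite -etaE dZ' !linearB linearZ /= eta_reeb (ptr_ker_eta hM DW) subr0
    mulr1 subrr.
have -> : dmap f p Z = dmap f p Z' + (dmap f p W + b *: reeb S (f p)).
  by rewrite dZ' [dmap f p W + _]addrC addrA !subrK.
rewrite !(metricDr (metricP S)) (metricZr (metricP S)) !metric_phi_skew.
rewrite (ambiguous_phi_orthogonal iD DX DZ') phi_reeb (metric0r (metricP S)).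
rewrite (metric_sym (metricP S)) (ptr_totally_real hM DW).
by rewrite oppr0 mulr0 !addr0.
Qed.

(** If [phi X] is normal, then any [Y] with [phi X - Y] normal is itself normal,
    hence zero. *)
Lemma totally_real_tangential_phi D p X :
  totally_real_at S f D p -> D p X -> tangential_phi S f p X = 0.
Proof.
move=> tr DX; have [_ inj] := ptr_immersion hM.
rewrite /tangential_phi; case: xgetP => [Y _ /(_ Y)|//].
rewrite (metricDl (metricP S)) (metricNl (metricP S)) (tr X DX Y) sub0r.
move=> /eqP; rewrite oppr_eq0 => /eqP g0; have dY := metric_eq0 (metricP S) g0.
by apply: (inj p); rewrite dY /dmap linear0.
Qed.

End Submanifold.

Theorem theorem5p7 (R : realType) (m n : nat)
    (N : manifold R m.*2.+1) (S : sasakian N)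
    (M : manifold R n) (f : M -> N) (Dperp : tangent_distr M)
    (hM : ptr_submanifold S f Dperp)
    (nabla : covder M) (hnabla : levi_civita (induced_metric S f) nabla) :
  (direct_ptr_product S nabla f Dperp ->
     forall (p : M) (X : 'rV[R]_n),
       ambiguous S f Dperp p X -> tangential_phi S f p X = 0) /\
  ((exists U : set M, proper_ptr_on S f Dperp U) ->
     ~ direct_ptr_product S nabla f Dperp).
Proof.
split=> [prod p X DX|[U properU] prod]; have iD := ambiguous_integrable prod.
  have tr : totally_real_at S f (ambiguous S f Dperp) p.
    exact: (totally_real_ambiguous hM iD).
  exact: (totally_real_tangential_phi hM tr DX).
apply: (proper_not_totally_real properU) => p _.
exact: (totally_real_ambiguous hM iD).
Qed.
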